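(* Let $A\in\mathbb{R}^{n\times n}$, $B\in\mathbb{R}^{n\times m}$, $C\in\mathbb{R}^{m\times n}$, $D\in\mathbb{R}^{m\times m}$, and let $P,S\in\mathbb{R}^{n\times n}$ satisfy $S^\top P=P^\top S$ and $\operatorname{rank}\begin{bmatrix}P\\S\end{bmatrix}=n$. Put $V(z):=\tfrac12 z^\top S^\top Pz$. Then, using $P\dot z=\dot x=APz+Bu$ (where $x=Pz$), the generalized dissipation inequality $$\begin{bmatrix} S^\top AP+P^\top A^\top S & S^\top B-P^\top C^\top\\ B^\top S-CP & -D-D^\top\end{bmatrix}\le 0$$ is equivalent to $$\frac{d}{dt}V(z)=z^\top S^\top P\dot z\le u^\top(CPz+Du).$$ Thus, although in case $P$ is singular the generalized dissipation inequality cannot be interpreted as a dissipation inequality for the original system $\dot x=Ax+Bu$, $y=Cx+Du$, it still can be interpreted as a dissipation inequality for the differential-algebraic system in the state variables $z$ $$P\dot z=APz+Bu,\qquad y=CPz+Du,$$ with singular pencil $sP-AP$ and storage function $V(z)=\tfrac12 z^\top S^\top Pz$.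
   Context: For a symmetric real matrix $X$, $X\le 0$ means negative semidefinite. The subspace $\mathcal{L}=\operatorname{im}\begin{bmatrix}P\\S\end{bmatrix}$ of $\mathcal{X}\times\mathcal{X}^*$ ($\mathcal{X}$ the $n$-dimensional state space, $\mathcal{X}^*$ its dual) is a Lagrange subspace, with elements $(x,p)=(Pz,Sz)$, $z$ ranging over an $n$-dimensional parametrization space. The generalized dissipation inequality is obtained by substituting $x=Pz$, $p=Sz$ in $H(x,p,u)\le 0$, where $H(x,p,u)=p^\top(Ax+Bu)-u^\top(Cx+Du)$. The traditional dissipation inequality, for a storage function $\tfrac12x^\top Qx$ with $Q=Q^\top$ expressed in the state $x$, corresponds to $p=Qx$. No nonnegativity of $S^\top P$ is assumed.
   Formalization: The equivalence is proved with Pż replaced by APz+Bu for free z,u; read on the DAE itself it fails for singular P (P=A=C=D=0, S=B=1), so there the converse is given only over (z,u) with APz+Bu in im P, and in full when all (z,u) are such. *)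

(* Defs.v *)
From mathcomp Require Import all_boot all_order all_algebra.
From mathcomp Require Import all_classical all_reals all_analysis.

Set Implicit Arguments.
Unset Strict Implicit.
Unset Printing Implicit Defensive.

Import Order.TTheory GRing.Theory Num.Theory.
Import numFieldNormedType.Exports.

Local Open Scope classical_set_scope.
Local Open Scope ring_scope.

Definition dotv (R : realType) (k : nat) (v w : 'cV[R]_k) : R :=
  (v^T *m w) 0 0.

Definition quadform (R : realType) (k : nat) (X : 'M[R]_k) (v : 'cV[R]_k) : R :=
  dotv v (X *m v).

Definition neg_semidef (R : realType) (k : nat) (X : 'M[R]_k) : Prop :=
  X^T = X /\ forall v : 'cV[R]_k, quadform X v <= 0.

Definition gdi_mx (R : realType) (n m : nat) (A : 'M[R]_n) (B : 'M[R]_(n, m))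
    (C : 'M[R]_(m, n)) (D : 'M[R]_m) (P S : 'M[R]_n) : 'M[R]_(n + m) :=
  block_mx (S^T *m A *m P + P^T *m A^T *m S) (S^T *m B - P^T *m C^T)
           (B^T *m S - C *m P)               (- D - D^T).

(* The state space and its dual are both identified with R^n. *)
Definition lagrange_subspace (R : realType) (n : nat) (P S : 'M[R]_n) :
    set ('cV[R]_n * 'cV[R]_n) :=
  [set xp | exists z : 'cV[R]_n, xp = (P *m z, S *m z)].

(* The subspace p = Q x attached to the storage function 1/2 x^T Q x. *)
Definition storage_graph (R : realType) (n : nat) (Q : 'M[R]_n) :
    set ('cV[R]_n * 'cV[R]_n) :=
  [set xp | xp.2 = Q *m xp.1].

Definition storage (R : realType) (n : nat) (P S : 'M[R]_n) (z : 'cV[R]_n) : R :=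
  2^-1 * dotv z (S^T *m P *m z).

(* The system P zdot = A P z + B u, y = C P z + D u at one instant of time;
   zdot is a vector here and becomes the derivative of z along curves. *)
Definition dae (R : realType) (n m : nat) (A : 'M[R]_n) (B : 'M[R]_(n, m))
    (C : 'M[R]_(m, n)) (D : 'M[R]_m) (P : 'M[R]_n)
    (z zdot : 'cV[R]_n) (u y : 'cV[R]_m) : Prop :=
  P *m zdot = A *m P *m z + B *m u /\ y = C *m P *m z + D *m u.

(* The pairs (z, u) meeting the algebraic constraints of the system, i.e.
   A P z + B u lies in the image of P. *)
Definition consistent (R : realType) (n m : nat) (A : 'M[R]_n)
    (B : 'M[R]_(n, m)) (P : 'M[R]_n) (z : 'cV[R]_n) (u : 'cV[R]_m) : Prop :=
  exists zdot : 'cV[R]_n, P *m zdot = A *m P *m z + B *m u.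

(* d/dt V(z) <= u^T y at every time t at which z is differentiable and the
   system equations hold; this covers all times of all solutions, and no
   regularity of u or y is needed. *)
Definition dae_dissipative (R : realType) (n m : nat) (A : 'M[R]_n)
    (B : 'M[R]_(n, m)) (C : 'M[R]_(m, n)) (D : 'M[R]_m) (P : 'M[R]_n)
    (V : 'cV[R]_n -> R) : Prop :=
  forall (z : R -> 'cV[R]_n) (u y : R -> 'cV[R]_m) (t : R),
    derivable z t 1 -> dae A B C D P (z t) ('D_1 z t) (u t) (y t) ->
    derivable (V \o z) t 1 /\ 'D_1 (V \o z) t <= dotv (u t) (y t).

(* The square pencil s E - F is singular: its determinant is the zero
   polynomial in s. *)
Definition singular_pencil (R : realType) (n : nat) (E F : 'M[R]_n) : Prop :=
  \det ('X *: map_mx polyC E - map_mx polyC F) = 0 :> {poly R}.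

(* Main.v *)
(** Expanding the quadratic form of the generalized dissipation inequality at
    [(z, u)] gives [2 (z^T S^T (A P z + B u) - u^T (C P z + D u))].  On the
    system, [A P z + B u] is [P zdot], and since [S^T P] is symmetric,
    [z^T S^T P zdot] is the derivative of the storage function; straight lines
    realize every [zdot] compatible with [(z, u)].  The pencil factors as
    [s P - A P = (s - A) P], so it is singular as soon as [P] is. *)
Require Import Defs.
From mathcomp Require Import all_boot all_order all_algebra.
From mathcomp Require Import all_classical all_reals all_analysis.
From mathcomp Require Import ring.

Import Order.TTheory GRing.Theory Num.Theory.
Import numFieldNormedType.Exports.

Local Open Scope ring_scope.

Section BilinearForms.
Context {R : realType}.
Implicit Types k n m : nat.

Lemma mx11_tr (M : 'M[R]_1) : M^T 0 0 = M 0 0.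
Proof. by rewrite mxE. Qed.

Lemma dotvC k (v w : 'cV[R]_k) : dotv v w = dotv w v.
Proof. by rewrite /dotv -mx11_tr trmx_mul trmxK. Qed.

Lemma dotv_adj k l (M : 'M[R]_(k, l)) (v : 'cV[R]_k) (w : 'cV[R]_l) :
  dotv v (M *m w) = dotv (M^T *m v) w.
Proof. by rewrite /dotv trmx_mul trmxK mulmxA. Qed.

Lemma dotvDr k (v w1 w2 : 'cV[R]_k) : dotv v (w1 + w2) = dotv v w1 + dotv v w2.
Proof. by rewrite /dotv mulmxDr mxE. Qed.

Lemma dotvNr k (v w : 'cV[R]_k) : dotv v (- w) = - dotv v w.
Proof. by rewrite /dotv mulmxN mxE. Qed.

Lemma dotv_col_mx k l (v1 w1 : 'cV[R]_k) (v2 w2 : 'cV[R]_l) :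
  dotv (col_mx v1 v2) (col_mx w1 w2) = dotv v1 w1 + dotv v2 w2.
Proof. by rewrite /dotv tr_col_mx mul_row_col mxE. Qed.

Lemma is_derive_coord {m n} {M : R -> 'M[R]_(m, n)} {t : R} i j :
  derivable M t 1 -> is_derive t 1 (fun s => M s i j) ('D_1 M t i j).
Proof.
move=> dM; rewrite derive_mx // mxE.
by apply: derivableP; move/derivable_mxP: dM.
Qed.

(** The product rule, reduced to scalar coordinates by expanding the form into a double sum. *)
Lemma is_derive_dotv {k} (M : 'M[R]_k) {z : R -> 'cV[R]_k} {t : R} :
  derivable z t 1 ->
  is_derive t 1 (fun s => dotv (z s) (M *m z s))
    (dotv (z t) (M *m 'D_1 z t) + dotv ('D_1 z t) (M *m z t)).
Proof.
move=> dz; pose dzc i := is_derive_coord i 0 dz.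
have E (v w : 'cV[R]_k) :
    dotv v (M *m w) = \sum_i \sum_j M i j * (v i 0 * w j 0).
  rewrite /dotv mxE; apply: eq_bigr => i _.
  rewrite mxE [X in _ * X]mxE mulr_sumr; apply: eq_bigr => j _.
  by rewrite mulrCA.
(* Written with sums, products and scalings of functions, the form is differentiated by instance
   resolution, with [dzc] supplying the coordinates. *)
have -> : (fun s => dotv (z s) (M *m z s)) =
   \sum_i \sum_j M i j *: ((fun s => z s i 0) * (fun s => z s j 0)).
  apply/funext => s; rewrite E fct_sumE; apply: eq_bigr => i _.
  by rewrite fct_sumE.
apply: is_derive_eq.
rewrite !E -big_split; apply: eq_bigr => i _ /=.
rewrite -big_split; apply: eq_bigr => j _ /=.
by rewrite -mulrDr [_ *: _]/(_ * _) [X in _ = _ * (_ + X)]mulrC.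
Qed.

End BilinearForms.

Section GeneralizedDissipation.
Context {R : realType} {n m : nat}.
Context {A : 'M[R]_n} {B : 'M[R]_(n, m)} {C : 'M[R]_(m, n)} {D : 'M[R]_m}.
Context {P S : 'M[R]_n}.

Lemma gdi_mx_sym : (gdi_mx A B C D P S)^T = gdi_mx A B C D P S.
Proof.
rewrite /gdi_mx tr_block_mx; congr block_mx.
- by rewrite raddfD /= addrC !trmx_mul !trmxK !mulmxA.
- by rewrite raddfB /= !trmx_mul trmxK.
- by rewrite raddfB /= !trmx_mul !trmxK.
- by rewrite raddfB raddfN /= trmxK addrC.
Qed.

Lemma quadform_gdi z u :
  quadform (gdi_mx A B C D P S) (col_mx z u) =
  2 * (dotv z (S^T *m (A *m P *m z + B *m u)) - dotv u (C *m P *m z + D *m u)).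
Proof.
rewrite /quadform /gdi_mx mul_block_col dotv_col_mx.
rewrite !mulmxDl !mulNmx !mulmxDr !dotvDr !dotvNr.
(* A scalar equals its transpose, so each term coincides with the one from the transposed block;
   this produces the factor 2. *)
have -> : dotv z (P^T *m A^T *m S *m z) = dotv z (S^T *m A *m P *m z).
  by rewrite dotv_adj dotvC !trmx_mul !trmxK !mulmxA.
have -> : dotv z (P^T *m C^T *m u) = dotv u (C *m P *m z).
  by rewrite dotv_adj dotvC !trmx_mul !trmxK.
have -> : dotv u (B^T *m S *m z) = dotv z (S^T *m B *m u).
  by rewrite dotv_adj dotvC !trmx_mul !trmxK.
have -> : dotv u (D^T *m u) = dotv u (D *m u).
  by rewrite dotv_adj dotvC trmxK.
by rewrite !mulmxA; ring.
Qed.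

Lemma quadform_gdi_le0 z u :
  (quadform (gdi_mx A B C D P S) (col_mx z u) <= 0) =
  (dotv z (S^T *m (A *m P *m z + B *m u)) <= dotv u (C *m P *m z + D *m u)).
Proof. by rewrite quadform_gdi pmulr_rle0 // subr_le0. Qed.

(** The blocks make the matrix symmetric, and every vector of length [n + m] splits as
    [col_mx z u]. *)
Lemma neg_semidef_gdi :
  neg_semidef (gdi_mx A B C D P S) <->
  forall z u, quadform (gdi_mx A B C D P S) (col_mx z u) <= 0.
Proof.
split=> [[_ H] z u | H]; first exact: H.
by split=> [|v]; [exact: gdi_mx_sym | rewrite -[v]vsubmxK].
Qed.

Lemma quadform_gdi_dae {z zdot u y} :
  dae A B C D P z zdot u y ->
  (quadform (gdi_mx A B C D P S) (col_mx z u) <= 0) =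
  (dotv z (S^T *m P *m zdot) <= dotv u y).
Proof. by case=> e ->; rewrite quadform_gdi_le0 -e mulmxA. Qed.

(** Symmetry of [S^T *m P] makes the two terms of the product rule equal, which cancels the factor
    1/2. *)
Lemma is_derive_storage {z : R -> 'cV[R]_n} {t : R} :
  S^T *m P = P^T *m S -> derivable z t 1 ->
  is_derive t 1 (storage P S \o z) (dotv (z t) (S^T *m P *m 'D_1 z t)).
Proof.
move=> hsym dz.
have dq := is_derive_dotv (S^T *m P) dz.
have -> : storage P S \o z = 2^-1 *: (fun s => dotv (z s) (S^T *m P *m z s)).
  by [].
apply: is_derive_eq.
have -> : dotv ('D_1 z t) (S^T *m P *m z t) = dotv (z t) (S^T *m P *m 'D_1 z t).
  by rewrite dotv_adj dotvC trmx_mul trmxK -hsym.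
suff half (x : R) : 2^-1 * (x + x) = x by exact: half.
by field.
Qed.

(** Curves obeying the system at time [t] pass through consistent pairs only, so dissipativity tests
    the quadratic form exactly there. *)
Lemma dae_dissipativeE :
  S^T *m P = P^T *m S ->
  dae_dissipative A B C D P (storage P S) <->
  forall z u, consistent A B P z u ->
    quadform (gdi_mx A B C D P S) (col_mx z u) <= 0.
Proof.
move=> hsym; split=> [H z u [zdot e] | H z u y t dz e].
  (* The straight line through [z] with velocity [zdot], taken with constant [u] and [y]: the system
     equations have to hold at time 0 only. *)
  pose c (s : R) : 'cV[R]_n := z + s *: zdot.
  have dc : is_derive (0 : R) (1 : R) c zdot.
    have dl : is_derive (0 : R) (1 : R) ( *:%R^~ zdot) zdot.
      apply: DeriveDef; first exact: diff_derivable.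
      by rewrite deriveE // diff_val scale1r.
    by rewrite -[zdot in is_derive _ _ _ zdot]add0r; exact: is_deriveD.
  have dcz : derivable c 0 1 by [].
  have c0 : c 0 = z by rewrite /c scale0r addr0.
  have De : dae A B C D P (c 0) ('D_1 c 0) u (C *m P *m z + D *m u).
    by rewrite derive_val c0; split.
  have [_] := H c (fun=> u) (fun=> C *m P *m z + D *m u) 0 dcz De.
  have dV := is_derive_storage hsym dcz.
  by rewrite derive_val -(quadform_gdi_dae De) c0.
have dV := is_derive_storage hsym dz.
split=> //; rewrite derive_val -(quadform_gdi_dae e); apply: H.
by case: e => e _; exists ('D_1 z t).
Qed.

(** A graph projects onto the whole state space, so the square matrix [P] is surjective, hence
    invertible. *)
Lemma lagrange_graph_unitmx (Q : 'M[R]_n) :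
  lagrange_subspace P S = storage_graph Q -> P \in unitmx.
Proof.
move=> e.
have Psurj (x : 'cV[R]_n) : exists z, P *m z = x.
  have : lagrange_subspace P S (x, Q *m x) by rewrite e.
  by case=> z [-> _]; exists z.
have [f Pf] := boolp.choice Psurj.
(* The chosen preimages of the unit vectors are the columns of a right inverse of [P]. *)
suff /mulmx1_unit[] : P *m (\matrix_(i, j) f (delta_mx j 0) i 0) = 1%:M by [].
apply/matrixP => i j; transitivity ((P *m f (delta_mx j 0)) i 0).
  by rewrite !mxE; apply: eq_bigr => k _; rewrite mxE.
by rewrite Pf !mxE eqxx andbT.
Qed.

Lemma singular_pencil_mulmx : P \notin unitmx -> singular_pencil P (A *m P).
Proof.
rewrite unitmxE unitfE negbK => /eqP detP0; rewrite /singular_pencil.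
(* Turning ['X *: P] into a product with a scalar matrix lets [P] factor out on the right. *)
rewrite map_mxM -mul_scalar_mx -mulmxBl det_mulmx det_map_mx detP0.
by rewrite rmorph0 mulr0.
Qed.

End GeneralizedDissipation.

Theorem mainTheorem4 (R : realType) (n m : nat)
    (A : 'M[R]_n) (B : 'M[R]_(n, m)) (C : 'M[R]_(m, n)) (D : 'M[R]_m)
    (P S : 'M[R]_n)
    (hsym : S^T *m P = P^T *m S)
    (hrank : \rank (col_mx P S) = n) :
  (* equivalence, with P zdot = xdot and xdot = A P z + B u *)
  (neg_semidef (gdi_mx A B C D P S) <->
     forall (z xdot : 'cV[R]_n) (u : 'cV[R]_m),
       xdot = A *m P *m z + B *m u ->
       dotv z (S^T *m xdot) <= dotv u (C *m P *m z + D *m u)) /\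
  (* d/dt V(z) = z^T S^T P zdot along differentiable curves *)
  (forall (z : R -> 'cV[R]_n) (t : R), derivable z t 1 ->
     is_derive t 1 (storage P S \o z) (dotv (z t) (S^T *m P *m 'D_1 z t))) /\
  (* equivalence of the two inequalities at each point of the system *)
  (forall (z zdot : 'cV[R]_n) (u y : 'cV[R]_m),
     dae A B C D P z zdot u y ->
     (quadform (gdi_mx A B C D P S) (col_mx z u) <= 0 <->
      dotv z (S^T *m P *m zdot) <= dotv u y)) /\
  (* interpretation as a dissipation inequality for the system in z *)
  (neg_semidef (gdi_mx A B C D P S) ->
     dae_dissipative A B C D P (storage P S)) /\
  (dae_dissipative A B C D P (storage P S) <->
     forall (z : 'cV[R]_n) (u : 'cV[R]_m), consistent A B P z u ->
       quadform (gdi_mx A B C D P S) (col_mx z u) <= 0) /\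
  ((forall (z : 'cV[R]_n) (u : 'cV[R]_m), consistent A B P z u) ->
     (neg_semidef (gdi_mx A B C D P S) <->
      dae_dissipative A B C D P (storage P S))) /\
  (* the case where P is singular *)
  (P \notin unitmx ->
     (~ exists Q : 'M[R]_n,
          Q^T = Q /\ lagrange_subspace P S = storage_graph Q) /\
     singular_pencil P (A *m P)).
Proof.
split.
  split=> [/neg_semidef_gdi H z _ u -> | H].
    by rewrite -quadform_gdi_le0.
  by apply/neg_semidef_gdi => z u; rewrite quadform_gdi_le0; exact: H.
split; first by move=> z t; exact: is_derive_storage.
split; first by move=> z zdot u y /quadform_gdi_dae ->.
split.
  by move=> /neg_semidef_gdi H; apply/dae_dissipativeE.
split; first exact: dae_dissipativeE.
split.
  (* With all pairs consistent, the restricted inequality is the full one. *)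
  move=> hc; split=> [/neg_semidef_gdi H | /(dae_dissipativeE hsym) H].
    exact/dae_dissipativeE.
  by apply/neg_semidef_gdi => z u; exact: H.
move=> Psing; split; last exact: singular_pencil_mulmx.
by case=> Q [_ /lagrange_graph_unitmx]; apply/negP.
Qed.
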